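(* Let $X$ and $Z$ be Hausdorff spaces and $Y$ be a topological vector space such that $Z\subset X\subset Y'_{w^*}$, with continuous injections, where $Y'_{w^*}$ is the dual space $Y'$ of $Y$ endowed with the weak-star topology, and assume $\mathfrak{B}_Z\subset\mathfrak{B}_X$. Let $I\subset\mathbb{R}$ be an interval and let $\mathcal{U}\subset\mathcal{X}_1$. Let $\rho$ be a $\mathcal{U}$-trajectory statistical solution over $I$ and let $\mathcal{V}$ be a Borel subset of $\mathcal{X}=\mathcal{C}_{\mathrm{loc}}(I,X)$ such that $\mathcal{V}\subset\mathcal{U}$ and $\rho(\mathcal{V})=1$. Suppose that there exist functions $\alpha:I\times X\to\mathbb{R}$ and $\beta:I\times Z\to\mathbb{R}$ which are $(\mathfrak{L}_I\otimes\mathfrak{B}_X,\mathfrak{B}_{\mathbb{R}})$-measurable and $(\mathfrak{L}_I\otimes\mathfrak{B}_Z,\mathfrak{B}_{\mathbb{R}})$-measurable, respectively, and satisfy the following conditions: (i) $(t,u)\mapsto\alpha(t,u(t))$ belongs to $L^1(J\times\mathcal{V},\lambda\times\rho)$, for every compact subset $J\subset I$; (ii) $(t,u)\mapsto\beta(t,u(t))$ belongs to $L^1(J\times\mathcal{V},\lambda\times\rho)$, for every compact subset $J\subset I$; (iii) for $\rho$-almost every $u\in\mathcal{V}$, $\frac{d}{dt}\alpha(t,u(t))+\beta(t,u(t))=0$ in the sense of distributions on $I$. Then $$-\int_I\int_{\mathcal{V}}\varphi'(s)\alpha(s,u(s))\,d\rho(u)\,ds+\int_I\int_{\mathcal{V}}\varphi(s)\beta(s,u(s))\,d\rho(u)\,ds=0$$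 and, with $\rho_t=\Pi_t\rho$ for $t\in I$, $$-\int_I\int_X\varphi'(s)\alpha(s,u)\,d\rho_s(u)\,ds+\int_I\int_X\varphi(s)\beta(s,u)\,d\rho_s(u)\,ds=0,$$ for any test function $\varphi\in\mathcal{C}^\infty_c(I)$.
   Context: $\mathfrak{B}_X$ denotes the Borel $\sigma$-algebra of a topological space; $\mathfrak{L}_I$ the Lebesgue $\sigma$-algebra of $I$; $\lambda$ the Lebesgue measure. Via the continuous injections, $Z$ is regarded as a subset of $X$ and $X$ as a subset of $Y'$; $\mathfrak{B}_Z\subset\mathfrak{B}_X$ means every Borel subset of $Z$ is a Borel subset of $X$. $\mathcal{C}^\infty_c(I)$ is the set of real-valued smooth functions compactly supported in the interior of $I$, and distributions on $I$ are tested against these. A Borel measure $\mu$ is tight if $\mu(A)=\sup\{\mu(K):K\subset A\text{ compact}\}$ for all Borel $A$. $\mathcal{X}=\mathcal{C}_{\mathrm{loc}}(I,X)$ is the set of continuous functions $u:I\to X$ with the compact-open topology (subbase $\{u:u(J)\subset O\}$, $J\subset I$ compact subinterval, $O\subset X$ open). $\Pi_tu=u(t)$ and $\Pi_t\rho$ is the push-forward of $\rho$ by $\Pi_t$. A $\mathcal{U}$-trajectory statistical solution over $I$ is a tight Borel probability measure $\rho$ on $\mathcal{X}$ for which there is $\mathcal{V}\in\mathfrak{B}_{\mathcal{X}}$ with $\mathcal{V}\subset\mathcal{U}$ and $\rho(\mathcal{X}\setminus\mathcal{V})=0$. A function $w:I\to Y'$ has a property weak-star scalarwise if $t\mapsto\langle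 w(t),v\rangle_{Y',Y}$ has the property for every $v\in Y$. $\mathcal{Y}_1$ is the set of $u:I\to Y'$ that are weak-star scalarwise absolutely continuous (on compact subintervals of $I$) and for which there is a weak-star scalarwise locally integrable $w:I\to Y'$ with $\frac{d}{dt}\langle u(t),v\rangle_{Y',Y}=\langle w(t),v\rangle_{Y',Y}$ for a.e. $t\in I$, for every $v\in Y$. Further, $\mathcal{Z}=\{u\in\mathcal{X}:u(t)\in Z\text{ for a.e. }t\in I\}$ and $\mathcal{X}_1=\mathcal{Z}\cap\mathcal{Y}_1$. For $u\in\mathcal{X}_1$, $\beta(t,u(t))$ is defined for a.e. $t\in I$; for a.e. $t\in I$, $\rho_t$ gives full measure to $Z$, so the integrals of $\beta(t,\cdot)$ with respect to $\rho_t$ make sense. *)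

(* Defs.v *)
From HB Require Import structures.
From mathcomp Require Import all_boot all_order all_algebra.
From mathcomp Require Import all_classical all_reals all_analysis.

Set Implicit Arguments.
Unset Strict Implicit.
Unset Printing Implicit Defensive.

Import Order.TTheory GRing.Theory Num.Theory.
Import numFieldNormedType.Exports.

Local Open Scope classical_set_scope.
Local Open Scope ring_scope.

(* In this library a [measurableType] has a designated point, whence
   [ptopologicalType]. *)
Definition borelType (T : ptopologicalType) := g_sigma_algebraType (@open T).
HB.instance Definition _ (T : ptopologicalType) := Measurable.on (borelType T).

(* R with the Lebesgue sigma-algebra, i.e. the domain of
   [completed_lebesgue_measure]; [lebesgue_measure] only lives on Borel sets. *)
Definition lebesgueType (R : realType) :=
  caratheodory_type ((wlength (@idfun R))^*)%mu.
HB.instance Definition _ (R : realType) := Measurable.on (lebesgueType R).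

Notation leb R :=
  (@completed_lebesgue_measure R : set (lebesgueType R) -> \bar R).

Section topological_dual.
Context (R : realType) (Y : topologicalLmodType R).

Definition topdual := {f : {scalar Y} | continuous f}.

HB.instance Definition _ := gen_eqMixin topdual.
HB.instance Definition _ := gen_choiceMixin topdual.

Definition pairing (f : topdual) (v : Y) : R := sval f v.

(* The weak-star topology. *)
HB.instance Definition _ := Topological.copy topdual
  (initial_topology (pairing : topdual -> {ptws Y -> R})).

End topological_dual.

Section continuous_trajectories.
Context (R : realType) (I : set R) (X : ptopologicalType).

Definition cloc := continuousType I X.

HB.instance Definition _ := Choice.on cloc.

Definition cloc_subbase (JO : set R * set X) : set cloc :=
  [set u : cloc | forall t : I, JO.1 (\val t) -> JO.2 (u t)].

HB.instance Definition _ := @isSubBaseTopological.Build cloc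
  (set R * set X)%type
  [set JO | [/\ JO.1 `<=` I, is_interval JO.1, compact JO.1 & open JO.2]]
  cloc_subbase.

HB.instance Definition _ := isPointed.Build cloc (cst (point : X)).

(* [u] as a total function on R, with a junk value outside [I]. *)
Definition traj (u : cloc) : R -> X := 'valL_ point u.

Definition evalt (t : R) (u : cloc) : X := traj u t.

End continuous_trajectories.

Section trajectory_statistical_solution.
Context (R : realType).
Local Open Scope ereal_scope.

Definition tight (T : ptopologicalType) (mu : set (borelType T) -> \bar R) :=
  forall A : set (borelType T), measurable A ->
    mu A = ereal_sup [set mu K | K in [set K : set T | compact K /\ K `<=` A]].

Definition trajectory_statistical_solution (I : set R) (X : ptopologicalType)
    (U : set (cloc I X)) (rho : probability (borelType (cloc I X)) R) :=
  tight rho /\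
  exists V : set (borelType (cloc I X)),
    [/\ measurable V, V `<=` U & rho (~` V) = 0].

End trajectory_statistical_solution.

Section scalarwise.
Context (R : realType).

Definition abs_continuous_on (a b : R) (f : R -> R) :=
  forall e : R, 0 < e -> exists2 d : R, 0 < d &
    forall (n : nat) (p : 'I_n -> R * R),
      (forall k, [/\ a <= (p k).1, (p k).1 <= (p k).2 & (p k).2 <= b]) ->
      trivIset setT (fun k => `](p k).1, (p k).2[%classic) ->
      \sum_(k < n) ((p k).2 - (p k).1) < d ->
      \sum_(k < n) `|f (p k).2 - f (p k).1| < e.

Definition loc_abs_continuous (I : set R) (f : R -> R) :=
  forall a b, `[a, b]%classic `<=` I -> abs_continuous_on a b f.

Definition loc_integrable (I : set R) (f : R -> R) :=
  forall J : set R, compact J -> J `<=` I ->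
    (leb R).-integrable J (EFin \o f).

(* The functions of the next definition have domain [I]; only their values on
   [I] matter, the endpoints of [I] being Lebesgue-negligible. *)
Definition Y1 (Y : topologicalLmodType R) (I : set R) : set (R -> topdual Y) :=
  [set u | (forall v, loc_abs_continuous I (fun t => pairing (u t) v)) /\
    exists w : R -> topdual Y,
      (forall v, loc_integrable I (fun t => pairing (w t) v)) /\
      (forall v, {ae leb R, forall t : R, I t ->
        is_derive t 1 (fun s : R => pairing (u s) v) (pairing (w t) v)})].

Definition X1 (I : set R) (Z X : ptopologicalType) (Y : topologicalLmodType R)
    (iZX : Z -> X) (iXY : X -> topdual Y) : set (cloc I X) :=
  [set u | {ae leb R, forall t : R, I t -> range iZX (traj u t)} /\
           Y1 I (iXY \o traj u)].

End scalarwise.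

Section distributions.
Context (R : realType).

(* A function on [I] supported in the interior of [I] is identified with its
   extension by zero to R. *)
Definition test_function (I : set R) (phi : R -> R) :=
  [/\ forall n x, derivable (derive1n n phi) x 1,
      compact (closure [set x | phi x != 0]) &
      closure [set x | phi x != 0] `<=` I°].

(* f' + g = 0 in the sense of distributions on I. As the equation is in
   \bar R, it entails that both integrals are finite. *)
Definition distr_deriv_add_eq0 (I : set R) (f g : R -> R) :=
  forall phi, test_function I phi ->
    (- (\int[leb R]_(t in I) (derive1 phi t * f t)%:E)
     + \int[leb R]_(t in I) (phi t * g t)%:E = 0)%E.

End distributions.

(* The extension by zero to X of a function on Z, along an injection Z -> X. *)
Definition ext0 (R : realType) (Z : pointedType) (X : choiceType)
    (i : Z -> X) (f : Z -> R) : X -> R :=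
  (f \o pinv setT i) \_ (range i).

(* Main.v *)
(** By Fubini, both iterated integrals may be exchanged, and for almost every
    trajectory [u] the inner time integrals then cancel by (iii).  Local
    integrability suffices because the test function vanishes outside a compact
    subset of [I].  The statement on the time marginals follows since
    [Pi_t] is Borel for [t] in [I], so that [rho_t] integrates measurable
    functions of [u(t)] by change of variables. *)

Require Import Defs.
From mathcomp Require Import all_boot all_order all_algebra.
From mathcomp Require Import all_classical all_reals all_analysis.
From mathcomp Require Import measurable_realfun.
Import Order.TTheory GRing.Theory Num.Theory.
Import numFieldNormedType.Exports.
Local Open Scope classical_set_scope.
Local Open Scope ring_scope.

(** * Sections, change of variables, and Fubini on rectangles *)

Lemma measurable_fun_section {d1 d2 d3} {T1 : measurableType d1}
    {T2 : measurableType d2} {T3 : measurableType d3} (A : set T1)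
    (f : T1 * T2 -> T3) (x : T1) :
  measurable A -> measurable_fun (A `*` setT) f -> A x ->
  measurable_fun [set: T2] (fun y => f (x, y)).
Proof.
move=> mA mf Ax; have mAT : measurable (A `*` @setT T2) by exact: measurableX.
apply: (measurable_comp mAT _ mf) => //.
by move=> _ [y _ <-].
Qed.

Section integration.
Local Open Scope ereal_scope.

(** Both sides integrate the same function once extended by zero to [T], so neither the sets nor [f]
    need be measurable. *)
Lemma integral_sub_support {d} {T : measurableType d} {R : realType}
    (mu : {measure set T -> \bar R}) (A B : set T) (f : T -> \bar R) :
  A `<=` B -> (forall x, B x -> ~ A x -> f x = 0) ->
  \int[mu]_(x in B) f x = \int[mu]_(x in A) f x.
Proof.
move=> AB f0; rewrite integral_mkcond [RHS]integral_mkcond; congr integral.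
apply/funext => x; rewrite !patchE.
have [xA|xA] := boolP (x \in A); first by rewrite (mem_set (AB _ (set_mem xA))).
case: ifPn => // /set_mem Bx; apply: f0 => // Ax.
by rewrite (mem_set Ax) in xA.
Qed.

Context {d1 d2 : measure_display} {T1 : measurableType d1}
  {T2 : measurableType d2} {R : realType}.

(** The nonnegative change of variables is applied separately to the positive and negative parts. No
    integrability is asked, so the lemma serves at every single time, whereas Fubini would give
    integrability only at almost every time. *)
Lemma integral_pushforwardT (phi : T1 -> T2) (mu : {measure set T1 -> \bar R})
    (f : T2 -> \bar R) :
  measurable_fun [set: T1] phi -> measurable_fun [set: T2] f ->
  \int[pushforward mu phi]_y f y = \int[mu]_x f (phi x).
Proof.
move=> mphi mf; rewrite [LHS]integralE [RHS]integralE.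
congr (_ - _).
- rewrite ge0_integral_pushforward ?preimage_setT//.
    by apply: eq_integral => x _; rewrite /= ?funeposE ?funenegE.
  exact: measurable_funepos.
- rewrite ge0_integral_pushforward ?preimage_setT//.
    by apply: eq_integral => x _; rewrite /= ?funeposE ?funenegE.
  exact: measurable_funeneg.
Qed.

Section fubini.
Variables (m1 : {sigma_finite_measure set T1 -> \bar R})
  (m2 : {sigma_finite_measure set T2 -> \bar R})
  (A : set T1) (B : set T2) (mA : measurable A) (mB : measurable B).

Lemma integral_setX1 (f : T1 * T2 -> \bar R) :
  \int[m1]_(x in A) \int[m2]_(y in B) f (x, y) =
  \int[m1]_x \int[m2]_y (f \_ (A `*` B)) (x, y).
Proof.
rewrite integral_mkcond; apply: eq_integral => x _; rewrite patchE.
case: ifPn => xA; last first.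
  by rewrite integral0_eq// => y _; rewrite patchE in_setX (negbTE xA).
rewrite integral_mkcond; apply: eq_integral => y _.
by rewrite !patchE in_setX xA.
Qed.

(** Transfers Fubini's theorem from the full product to [A] times [B]: for [y] outside [B], the zero
    extension has a vanishing section. *)
Lemma fubini_G_patch (f : T1 * T2 -> \bar R) :
  fubini_G m1 (f \_ (A `*` B)) = (fun y => \int[m1]_(x in A) f (x, y)) \_ B.
Proof.
apply/funext => y; rewrite /fubini_G patchE.
case: ifPn => yB; last first.
  by rewrite integral0_eq// => x _; rewrite patchE in_setX (negbTE yB) andbF.
rewrite [RHS]integral_mkcond; apply: eq_integral => x _.
by rewrite !patchE in_setX yB andbT.
Qed.

Lemma measurable_integral_section (f : T1 * T2 -> \bar R) :
  (m1 \x m2).-integrable (A `*` B) f ->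
  measurable_fun B (fun y => \int[m1]_(x in A) f (x, y)).
Proof.
move=> /(integrable_mkcond _ (measurableX mA mB)) fi.
apply/(measurable_restrictT _ mB); rewrite -fubini_G_patch.
exact: (measurable_fubini_G fi).
Qed.

Lemma Fubini_setX (f : T1 * T2 -> \bar R) :
  (m1 \x m2).-integrable (A `*` B) f ->
  \int[m1]_(x in A) \int[m2]_(y in B) f (x, y) =
  \int[m2]_(y in B) \int[m1]_(x in A) f (x, y).
Proof.
move=> /(integrable_mkcond _ (measurableX mA mB)) fi.
by rewrite integral_setX1 Fubini// [RHS]integral_mkcond -fubini_G_patch.
Qed.

Lemma fin_num_Fubini_setX (f : T1 * T2 -> \bar R) :
  (m1 \x m2).-integrable (A `*` B) f ->
  \int[m1]_(x in A) \int[m2]_(y in B) f (x, y) \is a fin_num.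
Proof.
move=> /(integrable_mkcond _ (measurableX mA mB)) fi.
by rewrite integral_setX1 integral12_prod_meas1//; exact: integrable_fin_num.
Qed.

(** After both exchanges of order, the inner integrals over [A] agree for almost every [y], hence so
    do the double integrals. Their common value is finite, which allows the subtraction in the
    extended reals. *)
Lemma integral_ae_oppeD_eq0 (f g : T1 * T2 -> \bar R) :
  (m1 \x m2).-integrable (A `*` B) f -> (m1 \x m2).-integrable (A `*` B) g ->
  {ae m2, forall y, B y ->
    - (\int[m1]_(x in A) f (x, y)) + \int[m1]_(x in A) g (x, y) = 0} ->
  - (\int[m1]_(x in A) \int[m2]_(y in B) f (x, y)) +
    \int[m1]_(x in A) \int[m2]_(y in B) g (x, y) = 0.
Proof.
move=> fi gi fg0.
suff -> : \int[m1]_(x in A) \int[m2]_(y in B) f (x, y) =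
          \int[m1]_(x in A) \int[m2]_(y in B) g (x, y).
  by rewrite addeC subee// fin_num_Fubini_setX.
rewrite !Fubini_setX//; apply: ae_eq_integral => //.
- exact: measurable_integral_section.
- exact: measurable_integral_section.
apply: filterS fg0 => y + By => /(_ By).
(* If either integral is infinite, then so is the sum, since opposite infinities add up to [-oo]; a
   zero sum thus leaves only the case of two reals. *)
case: (\int[m1]_(x in A) f (x, y)) => [r||];
  case: (\int[m1]_(x in A) g (x, y)) => [s||] //.
by move=> [/eqP]; rewrite addrC subr_eq0 => /eqP ->.
Qed.

End fubini.
End integration.

(** * Test functions and the Lebesgue sigma-algebra *)

Section lebesgue_type.
Context {R : realType}.
Implicit Types (A I : set R) (h phi : R -> R).

Lemma measurable_lebesgueType A :
  measurable A -> measurable (A : set (lebesgueType R)).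
Proof. exact: sub_caratheodory. Qed.

Lemma continuous_measurable_lebesgueType h : continuous h ->
  measurable_fun [set: lebesgueType R] (h : lebesgueType R -> R).
Proof.
move=> ch _ B mB; apply: measurable_lebesgueType.
exact: (continuous_measurable_fun ch).
Qed.

Lemma compact_measurable_lebesgueType A :
  compact A -> measurable (A : set (lebesgueType R)).
Proof.
move=> cA; apply: measurable_lebesgueType; apply: closed_measurable.
by apply: compact_closed => //; exact: Rhausdorff.
Qed.

Lemma test_function_continuous I phi :
  test_function I phi -> continuous phi /\ continuous (derive1 phi).
Proof.
move=> [dphi _ _]; split => x; apply: differentiable_continuous;
  apply/derivable1_diffP.
- exact: (dphi 0%N).
- exact: (dphi 1%N).
Qed.

Lemma test_function_eq0 phi x :
  ~ closure [set x | phi x != 0] x -> phi x = 0 /\ derive1 phi x = 0.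
Proof.
move=> nx.
(* The complement of the closed support is open, so [phi] vanishes on a whole neighbourhood of [x];
   this is what makes the derivative vanish too. *)
have phi0 : \forall y \near x, phi y = 0.
  have : nbhs x (~` closure [set x | phi x != 0]).
    apply: open_nbhs_nbhs; split => //.
    by apply: closed_openC; exact: closed_closure.
  apply: filterS => y ny; apply/eqP; apply: contrapT => /negP phiy.
  exact/ny/subset_closure.
split; first exact: nbhs_singleton phi0.
by rewrite derive1E (near_eq_derive (g := cst 0))// derive_cst.
Qed.

(** A continuous [h] is bounded on the compact set [A], and a bounded measurable factor preserves
    integrability. *)
Lemma integrable_continuous_mull {d} {T : measurableType d}
    (m : {measure set (lebesgueType R * T) -> \bar R}) A (B : set T) h
    (g : lebesgueType R * T -> R) :
  compact A -> measurable B -> continuous h ->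
  m.-integrable ((A : set (lebesgueType R)) `*` B) (EFin \o g) ->
  m.-integrable ((A : set (lebesgueType R)) `*` B) (fun p => (h p.1 * g p)%:E).
Proof.
move=> cA mB ch gi.
have mA := compact_measurable_lebesgueType _ cA.
have bh : [bounded h x | x in A].
  have : bounded_set (h @` A).
    apply: compact_bounded; apply: continuous_compact => //.
    exact: continuous_subspaceT.
  move=> [M [Mr hM]]; exists M; split => // x Mx y Ay.
  by apply: hM => //; exists y.
rewrite (_ : (fun p => _) = ((EFin \o (h \o fst)) \* (EFin \o g))%E)//.
apply: integrableMr => //.
  exact: measurableX.
  apply: measurable_funTS.
  exact: measurableT_comp (continuous_measurable_lebesgueType _ ch)
    measurable_fst.
move: bh => [M [Mr hM]]; exists M; split => // x Mx [y z] [/= Ay _].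
exact: hM.
Qed.

End lebesgue_type.

(** * Measurability of evaluation maps and of extensions by zero *)

Section trajectories.
Context {R : realType} {X Z : ptopologicalType} {I : set R}.

Lemma open_cloc_subbase (JO : set R * set X) :
  [/\ JO.1 `<=` I, is_interval JO.1, compact JO.1 & open JO.2] ->
  open (cloc_subbase JO : set (cloc I X)).
Proof.
move=> DJO; exists [set cloc_subbase JO]; last exact: bigcup_set1.
by move=> _ ->; exact: finI_from1.
Qed.

Lemma evaltE (t : I) (u : cloc I X) : evalt (\val t) u = u t.
Proof. exact: (congr1 (@^~ t) (valLK point (u : I -> X))). Qed.

(** It suffices to pull back open sets, and the preimage of an open [W] is the subbasic open set of
    the degenerate compact interval [[set t]] and [W]. *)
Lemma measurable_evalt (t : R) : I t ->
  measurable_fun [set: borelType (cloc I X)]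
    (evalt t : borelType (cloc I X) -> borelType X).
Proof.
move=> It; apply: (@measurability _ _ _ (borelType X) _ _ (@open X)) => //.
move=> _ [W oW <-].
rewrite setTI; apply: sub_sigma_algebra.
rewrite (_ : _ @^-1` _ = cloc_subbase ([set t], W)); last first.
  pose t' : I := SigSub (mem_set It).
  have evalt' u : evalt t u = u t' := evaltE t' u.
  apply/seteqP; split => [u Wu s st|u /(_ t' erefl)]; last first.
    by rewrite /preimage/= evalt'.
  have -> : s = t' by exact: val_inj.
  by rewrite -evalt'.
apply: open_cloc_subbase; split => //=.
- by move=> _ ->.
- by move=> x y /= -> -> z; rewrite -eq_le => /eqP.
- exact: compact_set1.
Qed.

(** The inclusion of Borel sets of [Z] among those of [X] is used twice: for the range of [i], and
    for the images under [i] of the preimages under [f]. *)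
Lemma measurable_ext0 (i : Z -> X) (f : borelType Z -> R) :
  injective i ->
  (forall B : set (borelType Z), measurable B ->
    measurable (i @` B : set (borelType X))) ->
  measurable_fun [set: borelType Z] f ->
  measurable_fun [set: borelType X] (ext0 i f : borelType X -> R).
Proof.
move=> inji mi mf; apply/(measurable_restrictT _ _).1.
  exact: mi.
move=> mR B mB.
have -> : range i `&` (f \o pinv setT i) @^-1` B = i @` (f @^-1` B).
  have iK z : pinv setT i (i z) = z by rewrite pinvKV ?inE//; exact: in2W.
  apply/seteqP; split => [_ [[z _ <-]] /=|_ [z Bz <-]] /=.
    by rewrite iK => Bz; exists z.
  by split; [exists z|rewrite iK].
by apply: mi; rewrite -[X in measurable X]setTI; exact: mf.
Qed.

End trajectories.

(** * Averaging over trajectories, then passing to the time marginals *)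

Theorem proposition3p2 (R : realType) (X Z : ptopologicalType)
    (Y : topologicalLmodType R)
    (hX : hausdorff_space X) (hZ : hausdorff_space Z)
    (iZX : Z -> X) (iXY : X -> topdual Y)
    (iZX_cont : continuous iZX) (iZX_inj : injective iZX)
    (iXY_cont : continuous iXY) (iXY_inj : injective iXY)
    (borelZX : forall B : set (borelType Z), measurable B ->
       measurable (iZX @` B : set (borelType X)))
    (I : set R) (hI : is_interval I)
    (U : set (cloc I X)) (hU : U `<=` X1 iZX iXY)
    (rho : probability (borelType (cloc I X)) R)
    (hrho : trajectory_statistical_solution U rho)
    (V : set (borelType (cloc I X))) (mV : measurable V)
    (VU : V `<=` U) (rhoV : rho V = 1%E)
    (alpha : R -> X -> R) (beta : R -> Z -> R)
    (malpha : measurable_fun ((I : set (lebesgueType R)) `*` [set: borelType X])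
       (fun p : lebesgueType R * borelType X => alpha p.1 p.2))
    (mbeta : measurable_fun ((I : set (lebesgueType R)) `*` [set: borelType Z])
       (fun p : lebesgueType R * borelType Z => beta p.1 p.2))
    (ialpha : forall J : set R, compact J -> J `<=` I ->
       (leb R \x rho)%E.-integrable ((J : set (lebesgueType R)) `*` V)
         (fun p => (alpha p.1 (traj p.2 p.1))%:E))
    (ibeta : forall J : set R, compact J -> J `<=` I ->
       (leb R \x rho)%E.-integrable ((J : set (lebesgueType R)) `*` V)
         (fun p => (ext0 iZX (beta p.1) (traj p.2 p.1))%:E))
    (hdistr : {ae rho, forall u, V u ->
       distr_deriv_add_eq0 I (fun t => alpha t (traj u t))
                             (fun t => ext0 iZX (beta t) (traj u t))}) :
  forall phi : R -> R, test_function I phi ->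
    (- (\int[leb R]_(s in I) \int[rho]_(u in V)
          (derive1 phi s * alpha s (traj u s))%:E)
     + \int[leb R]_(s in I) \int[rho]_(u in V)
          (phi s * ext0 iZX (beta s) (traj u s))%:E = 0)%E
    /\
    (let rho_ s : set (borelType X) -> \bar R :=
       pushforward rho (evalt s : borelType (cloc I X) -> borelType X) in
     - (\int[leb R]_(s in I) \int[rho_ s]_x (derive1 phi s * alpha s x)%:E)
     + \int[leb R]_(s in I) \int[rho_ s]_x (phi s * ext0 iZX (beta s) x)%:E
     = 0)%E.
Proof.
move=> phi tphi.
set K := closure [set x | phi x != 0].
have cK : compact K by case: tphi.
have KI : K `<=` I.
  by case: tphi => _ _ /subset_trans; apply; exact: interior_subset.
have mI : measurable (I : set (lebesgueType R)).
  by apply: measurable_lebesgueType; exact: is_interval_measurable.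
have mK := compact_measurable_lebesgueType _ cK.
have [cphi cdphi] := test_function_continuous _ _ tphi.
pose Omega := (lebesgueType R * borelType (cloc I X))%type.
pose a (p : Omega) : R := alpha p.1 (traj p.2 p.1).
pose b (p : Omega) : R := ext0 iZX (beta p.1) (traj p.2 p.1).
(* Conditions (i) and (ii) are used with [J] equal to the support [K] of [phi]. *)
have iF := integrable_continuous_mull _ K V _ a cK mV cdphi (ialpha _ cK KI).
have iG := integrable_continuous_mull _ K V _ b cK mV cphi (ibeta _ cK KI).
have IK (H : lebesgueType R -> \bar R) : (forall s, ~ K s -> H s = 0%E) ->
    (\int[leb R]_(s in I) H s = \int[leb R]_(s in K) H s)%E.
  by move=> H0; apply: integral_sub_support => // s _; exact: H0.
have dphi0 s : ~ K s -> derive1 phi s = 0 by move=> /test_function_eq0[].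
have phi0 s : ~ K s -> phi s = 0 by move=> /test_function_eq0[].
have eqV : (- (\int[leb R]_(s in I) \int[rho]_(u in V)
        (derive1 phi s * alpha s (traj u s))%:E)
     + \int[leb R]_(s in I) \int[rho]_(u in V)
        (phi s * ext0 iZX (beta s) (traj u s))%:E = 0)%E.
  rewrite IK; last first.
    by move=> s /dphi0 ->; rewrite integral0_eq// => u _; rewrite mul0r.
  rewrite IK; last first.
    by move=> s /phi0 ->; rewrite integral0_eq// => u _; rewrite mul0r.
  apply: (integral_ae_oppeD_eq0 _ _ _ _ mK mV _ _ iF iG).
  (* Condition (iii) is tested against [phi] itself; its integrals over [I] also reduce to [K]. *)
  apply: filterS hdistr => u + Vu => /(_ Vu _ tphi).
  rewrite IK; last by move=> s /dphi0 ->; rewrite mul0r.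
  by rewrite IK//; move=> s /phi0 ->; rewrite mul0r.
split; first exact: eqV.
rewrite /= -[RHS]eqV.
(* The marginals push forward [rho] from the whole trajectory space, while the first equation
   integrates over [V]; the complement of [V] is [rho]-null. *)
have VT (f : borelType (cloc I X) -> R) : measurable_fun setT f ->
    (\int[rho]_u (f u)%:E = \int[rho]_(u in V) (f u)%:E)%E.
  move=> mf; rewrite [RHS]integral_mkcond.
  apply: ae_eq_integral => //.
  - exact/measurable_EFinP.
  - by apply/(measurable_restrictT _ mV)/measurable_EFinP/measurable_funTS.
  exists (~` V); split.
  - exact: measurableC.
  - by have := probability_setC rho mV; rewrite rhoV subee.
  - move=> u /= H Vu; apply: H => _; by rewrite patchE mem_set.
(* At a fixed time [s] the test factor is a constant [h]. The inner integrals agree at every [s] in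
   [I], so the second equation follows from the first term by term. *)
have push (h : R) (f : borelType X -> R) s : I s -> measurable_fun setT f ->
   (\int[pushforward rho (evalt s : borelType (cloc I X) -> borelType X)]_x
      (h * f x)%:E = \int[rho]_(u in V) (h * f (traj u s))%:E)%E.
  move=> Is mf; have me := @measurable_evalt _ X _ _ Is.
  rewrite (integral_pushforwardT _ _ _ me); last first.
    by apply/measurable_EFinP; exact: measurable_funM.
  rewrite VT//; apply: measurable_funM => //; exact: measurableT_comp mf me.
congr (- _ + _)%E; apply: eq_integral => s /set_mem Is.
- apply: (push _ (alpha s)) => //.
  exact: (measurable_fun_section _ _ _ mI malpha Is).
- apply: (push _ (ext0 iZX (beta s))) => //; apply: measurable_ext0 => //.
  exact: (measurable_fun_section _ _ _ mI mbeta Is).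
Qed.
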